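(* Let $A\subseteq\mathbb{N}$. The following properties are equivalent: (1) There exist pairwise disjoint infinite sets $B,C,D\subseteq\mathbb{N}$ with $$\{b+c+c'+d+d'\mid b\in B,\ c,c'\in C,\ d,d'\in D,\ c\ne c',\ d\ne d',\ \text{and } b<c,c',d,d'\}\subseteq A.$$ (2) There exist distinct non-principal ultrafilters $\mathcal{U},\mathcal{V},\mathcal{W}$ on $\mathbb{N}$ such that $$A\in(\mathcal{U}\oplus\mathcal{V}\oplus\mathcal{V}\oplus\mathcal{W}\oplus\mathcal{W})\cap(\mathcal{U}\oplus\mathcal{V}\oplus\mathcal{W}\oplus\mathcal{V}\oplus\mathcal{W})\cap(\mathcal{U}\oplus\mathcal{V}\oplus\mathcal{W}\oplus\mathcal{W}\oplus\mathcal{V})$$ $$\cap\,(\mathcal{U}\oplus\mathcal{W}\oplus\mathcal{V}\oplus\mathcal{V}\oplus\mathcal{W})\cap(\mathcal{U}\oplus\mathcal{W}\oplus\mathcal{V}\oplus\mathcal{W}\oplus\mathcal{V})\cap(\mathcal{U}\oplus\mathcal{W}\oplus\mathcal{W}\oplus\mathcal{V}\oplus\mathcal{V}).$$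
   Context: $\mathbb{N}=\{1,2,3,\ldots\}$. The condition $b<c,c',d,d'$ means that $b$ is smaller than each of $c,c',d,d'$. The pseudo-sum of ultrafilters $\mathcal{U},\mathcal{V}$ on $\mathbb{N}$ is the ultrafilter $\mathcal{U}\oplus\mathcal{V}$ on $\mathbb{N}$ defined by $A\in\mathcal{U}\oplus\mathcal{V}\iff\{n\in\mathbb{N}\mid A-n\in\mathcal{V}\}\in\mathcal{U}$, where $A-n=\{m\in\mathbb{N}\mid m+n\in A\}$. This operation is associative (but not commutative). *)

(* Defs.v *)
From HB Require Import structures.
From mathcomp Require Import all_boot all_order all_algebra.
From mathcomp Require Import boolp classical_sets cardinality filter.
Set Implicit Arguments.
Unset Strict Implicit.
Unset Printing Implicit Defensive.

Local Open Scope classical_set_scope.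
Local Open Scope ring_scope.

(* The natural numbers start at 1. *)
Record posnat := Posnat { nat_of_posnat :> nat; _ : (0 < nat_of_posnat)%N }.

HB.instance Definition _ := [isSub for nat_of_posnat].
HB.instance Definition _ := [Countable of posnat by <:].

Lemma posnat_add_subproof (m n : posnat) : (0 < (m : nat) + (n : nat))%N.
Proof. by rewrite addn_gt0 (valP m). Qed.

Definition posnat_add (m n : posnat) : posnat :=
  Posnat (posnat_add_subproof m n).

Lemma posnat_addC : commutative posnat_add.
Proof. by move=> m n; apply: val_inj; apply: addnC. Qed.

Lemma posnat_addA : associative posnat_add.
Proof. by move=> m n p; apply: val_inj; apply: addnA. Qed.

HB.instance Definition _ :=
  GRing.isAddSemigroup.Build posnat posnat_addC posnat_addA.

Lemma posnat_addE (m n : posnat) : nat_of_posnat (m + n) = ((m : nat) + (n : nat))%N.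
Proof. by []. Qed.

Definition shift_set (A : set posnat) (n : posnat) : set posnat :=
  [set m | A (m + n)].

(* Defined on arbitrary families of sets; pseudo_sum_ultra below shows that it
   maps ultrafilters to ultrafilters. *)
Definition pseudo_sum (U V : set_system posnat) : set_system posnat :=
  [set A | U [set n | V (shift_set A n)]].

Declare Scope pseudo_sum_scope.
Delimit Scope pseudo_sum_scope with PS.
Notation "U ⊕ V" := (pseudo_sum U V)
  (at level 50, left associativity) : pseudo_sum_scope.
Open Scope pseudo_sum_scope.

Lemma pseudo_sumA : associative pseudo_sum.
Proof.
move=> U V W; apply/funext => A.
have shiftD (m n : posnat) : shift_set A (m + n) = shift_set (shift_set A n) m.
  by apply/funext => p; rewrite /shift_set /= Algebra.addrA.
congr (U _); apply/funext => n; congr (V _); apply/funext => m /=.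
by rewrite -shiftD.
Qed.

#[global] Instance pseudo_sum_ultra (U V : set_system posnat) :
  UltraFilter U -> UltraFilter V -> UltraFilter (U ⊕ V).
Proof.
move=> UU UV.
have UVfilter : Filter (U ⊕ V).
  split.
  - by apply: (@filterS _ U _ setT) filterT => n _; apply: filterT.
  - move=> P Q UP UQ; apply: (@filterS2 _ U _ _ _ _ _ UP UQ) => n.
    exact: (@filterI _ V).
  - move=> P Q PQ UP; apply: (@filterS _ U _ _ _ _ UP) => n.
    by apply: (@filterS _ V) => m; apply: PQ.
have UVproper : ProperFilter (U ⊕ V).
  split=> //; rewrite /pseudo_sum /= => Ufalse.
  apply: (@filter_not_empty _ U).
  by apply: filterS Ufalse => n; exact: (@filter_not_empty _ V).
split=> // G GG UVG; apply/seteqP; split=> // A GA.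
have [//|UnA] := in_ultra_setVsetC [set n | V (shift_set A n)] UU.
suff /UVG GnA : (U ⊕ V) (~` A).
  exfalso; apply: (@filter_not_empty _ G).
  by apply: filterS (filterI GA GnA) => x [].
rewrite /pseudo_sum /=; apply: filterS UnA => n /= nVA.
by have [/nVA|] := in_ultra_setVsetC (shift_set A n) UV.
Qed.

Definition nonprincipal (U : set_system posnat) : Prop :=
  forall n : posnat, U <> principal_filter n.

Definition pairwise_disjoint (B C D : set posnat) : Prop :=
  [/\ B `&` C = set0, B `&` D = set0 & C `&` D = set0].

(* Main.v *)
Require Import Defs.
From mathcomp Require Import all_boot all_order all_algebra.
From mathcomp Require Import boolp classical_sets cardinality filter.
From mathcomp Require Import zify.

(** By the definition of the pseudo-sum, [A] belongs to U ⊕ V ⊕ V ⊕ W ⊕ W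
    exactly when, for U-almost all b, then V-almost all c, then V-almost all c',
    then W-almost all d, then W-almost all d', the sum b + c + c' + d + d' is in
    [A] ([iterated_pseudo_sumE]); the five other pseudo-sums quantify over the
    same summands after b in the other orders.

    Given the sets [B], [C], [D], take nonprincipal ultrafilters containing
    them. Almost every element for such an ultrafilter exceeds any given bound,
    so in each of the six orders the summands can be taken increasing, hence
    distinct as required, and their sum is in [A] ([arrangement_large]). The
    ultrafilters are distinct because the sets are disjoint.

    Conversely, given the ultrafilters, build one increasing sequence
    x 0 < x 1 < x 2 < ..., whose terms are chosen according to U, V, W, U, V, W
    and so on. At each stage finitely many partial sums b, b + c, b + d, ... have
    been formed from earlier terms, and for each of them [A] is still large
    along every order of the missing summands; almost every new term preserves
    this for all of them simultaneously ([diagonal_sequence],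
    [sums_along_sequence]). Let [B], [C], [D] consist of the terms with index 0,
    1, 2 modulo 3. The sum of b and of larger c, c', d, d' is completed one
    summand at a time in increasing order, and this order is one of the six
    available, so the sum is in [A]. *)

Local Open Scope classical_set_scope.
Local Open Scope ring_scope.

(** * Iterated pseudo-sums *)

Definition add_all (b : posnat) (xs : seq posnat) : posnat :=
  foldl (fun s x => x + s) b xs.

(** Pseudo-sums unfold from the left: a set in U ⊕ F1 ⊕ ... ⊕ Fk is one
    such that for U-almost all b, F1-almost all n1, ..., Fk-almost all nk it
    contains b + n1 + ... + nk. Everything after the first quantifier is
    isolated here, with the partial sum already accumulated as an argument, so
    that one summand at a time can be fixed. *)
Fixpoint iterated_large (A : set posnat) (Fs : seq (set_system posnat))
    (s : posnat) : Prop :=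
  if Fs is F :: Fs' then F [set n | iterated_large A Fs' (n + s)] else A s.

Lemma iterated_pseudo_sumE (A : set posnat) (Fs : seq (set_system posnat))
    (U : set_system posnat) :
  foldl pseudo_sum U Fs A = U [set b | iterated_large A Fs b].
Proof. by elim: Fs U => [|F Fs IH] U //=; rewrite IH. Qed.

Lemma nat_add_all (b : posnat) (xs : seq posnat) :
  (add_all b xs : nat) = ((b : nat) + sumn [seq nat_of_posnat x | x <- xs])%N.
Proof.
elim: xs b => [|x xs IH] b; rewrite ?addn0 //=.
by rewrite IH posnat_addE addnA (addnC (x : nat)).
Qed.

(** * Nonprincipal ultrafilters on the positive integers *)

Lemma filter_all_seq (I : eqType) (T : Type) (F : set_system T) (s : seq I)
    (P : I -> set T) : Filter F ->
  (forall i, i \in s -> F (P i)) -> F [set x | forall i, i \in s -> P i x].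
Proof.
move=> FF; elim: s => [_|i s IH H]; first exact: (@filterS _ F _ setT) filterT.
have Hs : F [set x | forall j, j \in s -> P j x].
  by apply: IH => j js; apply: H; rewrite inE js orbT.
have Hi := H i (mem_head _ _).
apply: filterS (filterI Hi Hs) => x [Pi Ps] j.
by rewrite inE => /predU1P[->|/Ps].
Qed.

Lemma finite_bounded (X : set posnat) (m : nat) :
  (forall x, X x -> (x <= m)%N) -> finite_set X.
Proof.
move=> bX; apply/finite_seqP.
exists [seq x <- pmap insub (iota 1 m) | `[< X x >]].
apply/seteqP; split=> x /=; rewrite mem_filter; last by case/andP => /asboolP.
move=> Xx; apply/andP; split; first exact/asboolP.
by rewrite mem_pmap_sub mem_iota add1n ltnS (valP x); apply: bX.
Qed.

Lemma infinite_set_unboundedP (X : set posnat) :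
  infinite_set X <-> (forall m : nat, exists2 x : posnat, X x & (m < x)%N).
Proof.
split=> [infX m|unbX /finite_seqP[s Xs]].
  apply: contrapT => noX; apply: infX; apply: (@finite_bounded _ m) => x Xx.
  by rewrite leqNgt; apply/negP => mx; apply: noX; exists x.
have [x Xx] := unbX (\max_(y <- s) (y : nat)).
apply/negP; rewrite -leqNgt.
by apply: leq_bigmax_seq => //; move: Xx; rewrite Xs.
Qed.

(** For ultrafilters this is equivalent to being nonprincipal. It is the form
    in which nonprincipality is used: almost every element may be
    taken beyond all elements already chosen. *)
Definition contains_tails (F : set_system posnat) : Prop :=
  forall m : nat, F [set n : posnat | (m < n)%N].

Lemma nonprincipal_contains_tails (U : set_system posnat) :
  UltraFilter U -> nonprincipal U -> contains_tails U.
Proof.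
move=> UU npU; elim=> [|m IH].
  by apply: (@filterS _ U _ setT) filterT => n _; apply: (valP n).
have Hm : U [set n : posnat | (n : nat) <> m.+1].
  have [Um|//] := in_ultra_setVsetC [set n : posnat | (n : nat) = m.+1] UU.
  exfalso; apply: (npU (Posnat (ltn0Sn m))); apply/seteqP; split=> X /= UX.
    have [n [Xn /= nm]] := filter_ex (filterI UX Um).
    by move=> y ->; rewrite (_ : Posnat _ = n) //; apply: val_inj; rewrite /= nm.
  by apply: filterS Um => n /= nm; apply: UX; apply: val_inj; rewrite /= nm.
apply: filterS (filterI IH Hm) => n [/= mn /eqP nm].
by rewrite ltn_neqAle eq_sym nm.
Qed.

Lemma contains_tails_nonprincipal (U : set_system posnat) :
  contains_tails U -> nonprincipal U.
Proof.
move=> tU n Un; have := tU n.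
by rewrite Un => /(_ n erefl) /=; rewrite ltnn.
Qed.

(** Extend the filter of the sets containing all but boundedly many elements
    of [B], which is proper because [B] is unbounded. *)
Lemma infinite_nonprincipal_ultra {B : set posnat} : infinite_set B ->
  exists U, [/\ UltraFilter U, contains_tails U & U B].
Proof.
move=> /infinite_set_unboundedP infB.
pose F : set_system posnat :=
  [set X | exists m : nat, forall n : posnat, B n -> (m < n)%N -> X n].
have FF : ProperFilter F.
  split; first by move=> [m /= mF]; have [x /mF] := infB m; apply.
  split; first by exists 0.
  - move=> P Q [m mP] [k kQ]; exists (maxn m k) => n Bn.
    by rewrite gtn_max => /andP[/mP-/(_ Bn) ? /kQ-/(_ Bn) ?].
  - by move=> P Q PQ [m mP]; exists m => n Bn mn; apply/PQ/mP.
have [U [UU FU]] := ultraFilterLemma FF.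
by exists U; split=> // [m|]; apply: FU; [exists m|exists 0].
Qed.

Lemma ultra_neq_disjoint {U V : set_system posnat} {X Y : set posnat} :
  UltraFilter U -> U X -> V Y -> X `&` Y = set0 -> U <> V.
Proof.
move=> UU UX VY XY UV; apply: (@filter_not_empty _ U); rewrite -XY.
by apply: filterI => //; rewrite UV.
Qed.

(** * From infinite sets to pseudo-sums *)

(** As every tail is large, the summands may be taken in increasing order, so
    only sums with increasing summands from the sets [X i] matter. *)
Lemma increasing_iterated_large (A : set posnat) (T : Type)
    (F : T -> set_system posnat) (X : T -> set posnat) (w : seq T)
    (s : posnat) (m : nat) :
  (forall i, Filter (F i)) -> (forall i, contains_tails (F i)) ->
  (forall i, F i (X i)) ->
  (forall xs : seq posnat, size xs = size w ->
     path ltn m [seq nat_of_posnat x | x <- xs] ->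
     foldr and True [seq X p.1 p.2 | p <- zip w xs] -> A (add_all s xs)) ->
  iterated_large A (map F w) s.
Proof.
move=> FF Ft FX; elim: w s m => [|i w IH] s m H /=; first exact: (H [::]).
apply: filterS (filterI (Ft i m) (FX i)) => n [/= mn Xn].
apply: (IH _ n) => xs szxs pxs Xxs.
by apply: (H (n :: xs)); rewrite /= ?szxs ?mn.
Qed.

(** The orders in which two summands labelled 1 (from [V]) and two labelled 2
    (from [W]) can follow the first summand, which is labelled 0. *)
Definition arrangements : seq (seq nat) :=
  [:: [:: 1; 1; 2; 2]; [:: 1; 2; 1; 2]; [:: 1; 2; 2; 1];
      [:: 2; 1; 1; 2]; [:: 2; 1; 2; 1]; [:: 2; 2; 1; 1]]%N.

(** In an increasing choice of summands along an arrangement, the two drawn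
    from [C] are distinct, and so are the two drawn from [D]; addition being
    commutative, only their sizes relative to [b] and to each other are left of
    the arrangement. *)
Lemma arrangement_large (A C D : set posnat) (V W : set_system posnat)
    (b : posnat) (w : seq nat) :
  Filter V -> Filter W -> contains_tails V -> contains_tails W -> V C -> W D ->
  (forall c c' d d' : posnat, C c -> C c' -> D d -> D d' ->
     (b < c)%N -> (c < c')%N -> (b < d)%N -> (d < d')%N ->
     A (b + c + c' + d + d')) ->
  w \in arrangements ->
  iterated_large A (map (fun l => if l == 1%N then V else W) w) b.
Proof.
move=> FV FW tV tW VC WD H wS.
pose X l := if l == 1%N then C else D.
apply: (@increasing_iterated_large A _ _ X w b b) => [i|i|i|xs].
1,2,3: by rewrite /X; case: (i == 1%N).
have {}H c c' d d' (s : posnat) :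
    [/\ C c, C c', D d & D d'] -> [/\ b < c, c < c', b < d & d < d']%N ->
    (s : nat) = (b + c + c' + d + d')%N -> A s.
  move=> [? ? ? ?] [? ? ? ?] se.
  by rewrite (_ : s = b + c + c' + d + d'); [exact: H|exact: val_inj].
move: wS; rewrite !inE.
case: xs => [|x [|y [|z [|t [|? ?]]]]];
  (case/or4P=> [/eqP->|/eqP->|/eqP->|/or3P[/eqP->|/eqP->|/eqP->]] //= _).
all: case/and5P=> [? ? ? ? _] [? [? [? [? _]]]].
- by apply: (H x y z t) => //; [split; lia|rewrite !posnat_addE; lia].
- by apply: (H x z y t) => //; [split; lia|rewrite !posnat_addE; lia].
- by apply: (H x t y z) => //; [split; lia|rewrite !posnat_addE; lia].
- by apply: (H y z x t) => //; [split; lia|rewrite !posnat_addE; lia].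
- by apply: (H y t x z) => //; [split; lia|rewrite !posnat_addE; lia].
- by apply: (H z t x y) => //; [split; lia|rewrite !posnat_addE; lia].
Qed.

(** * From pseudo-sums to infinite sets *)

(** The next term is picked out of a finite intersection of members of [F i]:
    the values must stay increasing, and appending the term must keep every
    word built so far in [G]. Since all words over the earlier indices are
    maintained at once, the family [G] is reached along every subsequence of
    the final sequence, and not just along its initial segments. *)
Lemma diagonal_sequence (F : nat -> set_system posnat)
    (G : set (seq (nat * posnat))) :
  (forall i, ProperFilter (F i)) -> (forall i, contains_tails (F i)) ->
  G [::] ->
  (forall w i, G w -> F i [set n | G (rcons w (i, n))]) ->
  exists x : nat -> posnat,
    {homo x : i j / (i < j)%N >-> (i < j)%N} /\
    forall s, sorted ltn s -> G [seq (i, x i) | i <- s].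
Proof.
move=> FF Ft G0 GS.
(* p packs the current index, the words built so far, and the last value *)
have next (p : nat * seq (seq (nat * posnat)) * nat) : exists y : posnat,
    (forall w, w \in p.1.2 -> G w) ->
    (p.2 < y)%N /\ forall w, w \in p.1.2 -> G (rcons w (p.1.1, y)).
  case: (pselect (forall w, w \in p.1.2 -> G w)) => [Gp|?]; last first.
    by exists (Posnat (ltn0Sn 0)).
  have Fp : F p.1.1 [set y | forall w, w \in p.1.2 -> G (rcons w (p.1.1, y))].
    by apply: filter_all_seq => w wp; apply/GS/Gp.
  by have [y [? ?]] := filter_ex (filterI (Ft p.1.1 p.2) Fp); exists y.
have [f fP] := choice next.
pose step i (st : seq (seq (nat * posnat)) * nat) :=
  let y := f (i, st.1, st.2) in
  (st.1 ++ [seq rcons w (i, y) | w <- st.1], y : nat).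
pose state i := iteri i step ([:: [::]], 0%N).
pose x i := f (i, (state i).1, (state i).2).
have GL i w : w \in (state i).1 -> G w.
  elim: i w => [|i IH] w; first by rewrite inE => /eqP ->.
  rewrite /= mem_cat => /orP[/IH //|/mapP[v vL ->]].
  by have [|_ ] := fP (i, (state i).1, (state i).2); [exact: IH|apply].
have xS i : ((state i).2 < x i)%N.
  by have [|] := fP (i, (state i).1, (state i).2); first exact: GL.
exists x; split.
  by apply: homo_ltn => [? ? ? /ltn_trans|i]; [apply|exact: (xS i.+1)].
move=> s ss; suff L n : all (ltn^~ n) s -> [seq (i, x i) | i <- s] \in (state n).1.
  apply: (GL (\max_(i <- s) i).+1); apply: L; apply/allP => i si /=.
  by rewrite ltnS; apply: leq_bigmax_seq.
have mono i j : (i <= j)%N -> {subset (state i).1 <= (state j).1}.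
  move=> /subnK <-; elim: (j - i)%N => [|k IH] w // /IH wL.
  by rewrite addSn /= mem_cat wL.
move: ss; rewrite (sorted_pairwise ltn_trans).
elim/last_ind: s n => [|s i IH] n.
  by move=> _ _; apply: (mono 0%N); rewrite ?inE.
rewrite pairwise_rcons all_rcons map_rcons => /andP[si ps] /andP[/= ilt _].
apply: (mono i.+1) => //=; rewrite mem_cat; apply/orP; right.
by apply: map_f; apply: IH.
Qed.

(** The diagonal construction is applied to the words whose sum, so far, leaves
    [A] large along every way of completing their labels to a word of [S].
    For each single word of [S] almost every next summand preserves this, hence
    almost every one does so for all words of [S] at once, as [S] is finite. *)
Lemma sums_along_sequence (A : set posnat) (T : eqType)
    (F : T -> set_system posnat) (lab : nat -> T) (o : T) (S : seq (seq T)) :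
  (forall l, ProperFilter (F l)) -> (forall l, contains_tails (F l)) ->
  (forall w, w \in S -> foldl pseudo_sum (F o) (map F w) A) ->
  exists x : nat -> posnat,
    {homo x : i j / (i < j)%N >-> (i < j)%N} /\
    forall i t, path ltn i t -> lab i = o -> map lab t \in S ->
      A (add_all (x i) (map x t)).
Proof.
move=> FF Ft FS.
pose G (w : seq (nat * posnat)) : Prop :=
  if w is (i, b) :: t then
    lab i = o -> forall r, [seq lab p.1 | p <- t] ++ r \in S ->
      iterated_large A (map F r) (add_all b (unzip2 t))
  else True.
have GS w i : G w -> F (lab i) [set n | G (rcons w (i, n))].
  case: w => [_|[j b] t Gw].
    have [io|nio] := eqVneq (lab i) o; last first.
      by apply: (@filterS _ _ _ setT) filterT => n _ /= /eqP; rewrite (negPf nio).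
    have H : F o [set n | forall w, w \in S -> iterated_large A (map F w) n].
      by apply: filter_all_seq => w /FS; rewrite iterated_pseudo_sumE.
    by rewrite io; apply: filterS H => n Hn _ r; apply: Hn.
  case: (eqVneq (lab j) o) => [jo|njo]; last first.
    by apply: (@filterS _ _ _ setT) filterT => n _ /= /eqP; rewrite (negPf njo).
  (* at most one completion r exists for each w, so P w is a single condition *)
  pose P w := [set n | forall r, [seq lab p.1 | p <- t] ++ lab i :: r = w ->
    iterated_large A (map F r) (n + add_all b (unzip2 t))].
  have HS : F (lab i) [set n | forall w, w \in S -> P w n].
    apply: filter_all_seq => w wS.
    have [[r rw]|nr] :=
      pselect (exists r, [seq lab p.1 | p <- t] ++ lab i :: r = w).
      have := Gw jo (lab i :: r); rewrite rw => /(_ wS) /=.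
      apply: filterS => n Hn r' /eqP.
      by rewrite -rw eqseq_cat // eqxx /= eqseq_cons eqxx /= => /eqP ->.
    by apply: (@filterS _ _ _ setT) filterT => n _ r rw; case: nr; exists r.
  apply: filterS HS => n Hn /= _ r; rewrite map_rcons cat_rcons => rS.
  by rewrite /unzip2 map_rcons /add_all foldl_rcons; apply: (Hn _ rS).
have [x [xlt xG]] := diagonal_sequence (F \o lab) G (fun i => FF _) (fun i => Ft _) I GS.
exists x; split=> // i t pt io tS.
have := xG (i :: t) pt io [::].
by rewrite cats0 /unzip2 -!map_comp => /(_ tS).
Qed.

Lemma perm_arrangements (w : seq nat) :
  perm_eq w [:: 1; 1; 2; 2]%N -> w \in arrangements.
Proof.
by rewrite -mem_permutations; apply: (allP (_ : all (mem arrangements) _)).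
Qed.

Lemma infinite_residue_image (x : nat -> posnat) (r : nat) :
  {homo x : i j / (i < j)%N >-> (i < j)%N} -> (r < 3)%N ->
  infinite_set [set x i | i in [set i | (i %% 3)%N = r]].
Proof.
move=> xlt r3; apply/infinite_set_unboundedP => m.
have xge i : (i < x i)%N.
  elim: i => [|i IH]; first exact: (valP (x 0%N)).
  exact: leq_ltn_trans IH (xlt _ _ (ltnSn i)).
exists (x (m * 3 + r)%N); first by exists (m * 3 + r)%N; rewrite //= modnMDl modn_small.
by apply: leq_ltn_trans (xge _); rewrite (leq_trans _ (leq_addr _ _)) // leq_pmulr.
Qed.

Theorem proposition6p21 (A : set posnat) :
  (exists B C D : set posnat,
     [/\ infinite_set B, infinite_set C, infinite_set D,
         pairwise_disjoint B C D &
         [set n : posnat | exists b c c' d d' : posnat,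
            [/\ [/\ B b, C c, C c', D d & D d'],
                c <> c', d <> d',
                [/\ (b < c)%N, (b < c')%N, (b < d)%N & (b < d')%N] &
                n = b + c + c' + d + d']] `<=` A])
  <->
  (exists U V W : set_system posnat,
     [/\ [/\ UltraFilter U, UltraFilter V & UltraFilter W],
         [/\ nonprincipal U, nonprincipal V & nonprincipal W],
         [/\ U <> V, U <> W & V <> W] &
         ((U ⊕ V ⊕ V ⊕ W ⊕ W) `&` (U ⊕ V ⊕ W ⊕ V ⊕ W) `&`
          (U ⊕ V ⊕ W ⊕ W ⊕ V) `&` (U ⊕ W ⊕ V ⊕ V ⊕ W) `&`
          (U ⊕ W ⊕ V ⊕ W ⊕ V) `&` (U ⊕ W ⊕ W ⊕ V ⊕ V)) A]).
Proof.
split.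
  move=> [B [C [D [infB infC infD [BC BD CD] sumA]]]].
  have [U [UU tU UB]] := infinite_nonprincipal_ultra infB.
  have [V [UV tV VC]] := infinite_nonprincipal_ultra infC.
  have [W [UW tW WD]] := infinite_nonprincipal_ultra infD.
  exists U, V, W; split=> //.
  - by split; apply: contains_tails_nonprincipal.
  - split; first exact: ultra_neq_disjoint UB VC BC.
      exact: ultra_neq_disjoint UB WD BD.
    exact: ultra_neq_disjoint VC WD CD.
  pose F l := if l == 1%N then V else W.
  have H w : w \in arrangements -> foldl pseudo_sum U (map F w) A.
    move=> wS; rewrite iterated_pseudo_sumE; apply: filterS UB => b Bb.
    apply: arrangement_large VC WD _ wS => // c c' d d'.
    move=> Cc Cc' Dd Dd' bc cc' bd dd'.
    have lt_neq (y z : posnat) : (y < z)%N -> y <> z.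
      by move=> yz eyz; move: yz; rewrite eyz ltnn.
    apply: sumA; exists b, c, c', d, d'; split=> //; try exact: lt_neq.
    by split=> //; [exact: ltn_trans cc'|exact: ltn_trans dd'].
  do !split.
  - by apply: (H [:: 1; 1; 2; 2]%N).
  - by apply: (H [:: 1; 2; 1; 2]%N).
  - by apply: (H [:: 1; 2; 2; 1]%N).
  - by apply: (H [:: 2; 1; 1; 2]%N).
  - by apply: (H [:: 2; 1; 2; 1]%N).
  - by apply: (H [:: 2; 2; 1; 1]%N).
move=> [U [V [W [[UU UV UW] [npU npV npW] _ [[[[[A1 A2] A3] A4] A5] A6]]]]].
pose F l := if l == 0%N then U else if l == 1%N then V else W.
have FU l : UltraFilter (F l) by rewrite /F; case: (l == 0%N); case: (l == 1%N).
have Ft l : contains_tails (F l).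
  by rewrite /F; case: (l == 0%N); case: (l == 1%N); apply: nonprincipal_contains_tails.
(* the terms of the sequence are handed out to U, V and W cyclically *)
have [] := @sums_along_sequence A _ F (modn^~ 3) 0%N arrangements _ Ft.
  move=> w; rewrite !inE.
  by case/or4P=> [/eqP->|/eqP->|/eqP->|/or3P[/eqP->|/eqP->|/eqP->]].
move=> x [xlt xA].
have x_neq i j : i <> j -> x i <> x j.
  move=> /eqP; rewrite neq_ltn => /orP[] /xlt lt_x e.
    by rewrite e ltnn in lt_x.
  by rewrite e ltnn in lt_x.
have x_reflect i j : (x i < x j)%N -> (i < j)%N.
  case: (ltngtP i j) => [//|/xlt ji ij|->]; last by rewrite ltnn.
  by have := ltn_trans ij ji; rewrite ltnn.
pose R r := [set x i | i in [set i | (i %% 3)%N = r]].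
have disj r s : r <> s -> R r `&` R s = set0.
  move=> rs; apply/seteqP; split=> // y [[i /= ir <-] [j /= js xji]].
  by apply: (x_neq i j) => // ij; apply: rs; rewrite -ir -js ij.
exists (R 0%N), (R 1%N), (R 2%N); split.
1,2,3: exact: infinite_residue_image.
  by split; apply: disj.
move=> n [b [c [c' [d [d' [[]]]]]]].
move=> [i ri <-] [i1 r1 <-] [i2 r2 <-] [i3 r3 <-] [i4 r4 <-].
move=> cc' dd' [/x_reflect b1 /x_reflect b2 /x_reflect b3 /x_reflect b4] ->.
(* listing the four indices increasingly makes their labels an arrangement *)
pose l := [:: i1; i2; i3; i4]; pose t := sort leq l.
have tl : perm_eq t l by rewrite perm_sort.
have ul : uniq l.
  rewrite /= !inE !negb_or.
  have /eqP -> : i1 <> i2 by move=> e; apply: cc'; rewrite e.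
  have /eqP -> : i3 <> i4 by move=> e; apply: dd'; rewrite e.
  have neq j k : (j %% 3 = 1)%N -> (k %% 3 = 2)%N -> j != k.
    by move=> rj rk; apply/eqP => e; move: rj; rewrite e rk.
  by rewrite (neq _ _ r1 r3) (neq _ _ r1 r4) (neq _ _ r2 r3) (neq _ _ r2 r4).
have pt : path ltn i t.
  rewrite path_min_sorted; last by rewrite (perm_all _ tl) /= b1 b2 b3 b4.
  by rewrite ltn_sorted_uniq_leq sort_uniq ul sort_sorted //; apply: leq_total.
have mt : map (modn^~ 3) t \in arrangements.
  apply: perm_arrangements; apply: perm_trans (perm_map _ tl) _.
  by move: r1 r2 r3 r4 => /= -> -> -> ->.
suff -> : x i + x i1 + x i2 + x i3 + x i4 = add_all (x i) (map x t) by exact: xA.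
apply: val_inj; rewrite /= nat_add_all (perm_sumn (perm_map _ (perm_map x tl))) /=.
by rewrite addn0 !addnA.
Qed.
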